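(* Up to isomorphism, the real Lie algebra $\mathfrak{h}_3\oplus\mathfrak{h}_5$ has exactly one rational form.
   Context: $\mathfrak{h}_{2m+1}$ denotes the real Heisenberg Lie algebra with basis $X_1,\dots,X_{2m},Z$ and brackets $[X_1,X_2]=[X_3,X_4]=\dots=[X_{2m-1},X_{2m}]=Z$ (all brackets of basis elements not determined by these via antisymmetry being zero). A rational form of a real Lie algebra $\mathfrak{n}$ of dimension $n$ is an $n$-dimensional $\mathbb{Q}$-subspace $\mathfrak{n}^{\mathbb{Q}}\subset\mathfrak{n}$, closed under the Lie bracket, with $\mathfrak{n}^{\mathbb{Q}}\otimes\mathbb{R}=\mathfrak{n}$. Two rational forms $\mathfrak{n}^{\mathbb{Q}}_1,\mathfrak{n}^{\mathbb{Q}}_2$ of $\mathfrak{n}$ are isomorphic if $A\mathfrak{n}^{\mathbb{Q}}_1=\mathfrak{n}^{\mathbb{Q}}_2$ for some $A\in\mathrm{Aut}(\mathfrak{n})$, equivalently if they are isomorphic as Lie algebras over $\mathbb{Q}$. *)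

(* Defs.v *)
From HB Require Import structures.
From mathcomp Require Import all_boot all_order all_algebra.
From mathcomp Require Import boolp classical_sets reals.
From mathcomp Require Import ring zify.

Set Implicit Arguments.
Unset Strict Implicit.
Unset Printing Implicit Defensive.

Import Order.TTheory GRing.Theory Num.Theory.
Local Open Scope classical_set_scope.
Local Open Scope ring_scope.

HB.mixin Record Vector_isLie (K : fieldType) L of Vector K L := {
  lie : L -> L -> L;
  lie_linearl : forall v, linear (lie^~ v);
  lie_linearr : forall u, linear (lie u);
  liexx : forall u, lie u u = 0;
  lie_jacobi : forall u v w,
    lie u (lie v w) + lie v (lie w u) + lie w (lie u v) = 0
}.

#[short(type="lieAlgType")]
HB.structure Definition LieAlgebra (K : fieldType) :=
  { L of Vector K L & Vector_isLie K L }.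

(* The basis X_1, ..., X_2m, Z is the standard basis of row vectors, with
   X_(k + 1) at the 0-based index k < 2m, and Z at the last index 2m. *)
Definition heisenberg (K : fieldType) (m : nat) := 'rV[K]_(m.*2.+1).

HB.instance Definition _ (K : fieldType) (m : nat) :=
  Vector.on (heisenberg K m).

Section Heisenberg.
Variables (K : fieldType) (m : nat).
Local Notation h := (heisenberg K m).

Definition heis_basis (k : nat) : h := delta_mx 0 (inord k).

Definition heis_Z : h := delta_mx 0 ord_max.

Definition heis_form (u v : h) : K :=
  \sum_(i < m) (u 0 (inord i.*2) * v 0 (inord i.*2.+1)
                - u 0 (inord i.*2.+1) * v 0 (inord i.*2)).

Definition heis_lie (u v : h) : h := heis_form u v *: heis_Z.

Fact heis_lie_linearl v : linear (heis_lie^~ v).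
Proof.
move=> a x y; rewrite /heis_lie scalerA -scalerDl; congr (_ *: _).
rewrite /heis_form mulr_sumr -big_split /=; apply: eq_bigr => i _.
by rewrite !mxE; ring.
Qed.

Fact heis_lie_linearr u : linear (heis_lie u).
Proof.
move=> a x y; rewrite /heis_lie scalerA -scalerDl; congr (_ *: _).
rewrite /heis_form mulr_sumr -big_split /=; apply: eq_bigr => i _.
by rewrite !mxE; ring.
Qed.

Fact heis_liexx u : heis_lie u u = 0.
Proof.
rewrite /heis_lie /heis_form big1 ?scale0r// => i _.
by rewrite mulrC subrr.
Qed.

Fact heis_lieZr u a : heis_lie u (a *: heis_Z) = 0.
Proof.
rewrite /heis_lie /heis_form big1 ?scale0r// => i _.
have ltim : (i.*2.+1 < m.*2)%N by have := ltn_ord i; lia.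
rewrite !mxE -!val_eqE /= !inordK; try lia.
have -> : (i.*2 == m.*2) = false by lia.
have -> : (i.*2.+1 == m.*2) = false by lia.
by rewrite !mulr0 subrr.
Qed.

Fact heis_lie_jacobi u v w :
  heis_lie u (heis_lie v w) + heis_lie v (heis_lie w u)
  + heis_lie w (heis_lie u v) = 0.
Proof. by rewrite !heis_lieZr !addr0. Qed.

HB.instance Definition _ := Vector_isLie.Build K h
  heis_lie_linearl heis_lie_linearr heis_liexx heis_lie_jacobi.

Lemma lie_heis_basis (j k : nat) : (j < k < m.*2)%N ->
  lie (heis_basis j) (heis_basis k) =
  if ~~ odd j && (k == j.+1) then heis_Z else 0.
Proof.
move=> /andP[ltjk ltkm].
have inordE a b : (a < m.*2.+1)%N -> (b < m.*2.+1)%N ->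
    ((inord a : 'I_m.*2.+1) == inord b) = (a == b).
  by move=> ltam ltbm; rewrite -val_eqE /= !inordK.
have termE (i : 'I_m) :
    heis_basis j 0 (inord i.*2) * heis_basis k 0 (inord i.*2.+1)
    - heis_basis j 0 (inord i.*2.+1) * heis_basis k 0 (inord i.*2)
    = ((i.*2 == j) && (i.*2.+1 == k))%:R :> K.
  have := ltn_ord i; move: (nat_of_ord i) => {}i ltim.
  rewrite !mxE eqxx /= !inordE; try lia.
  rewrite -!natrM !mulnb.
  have -> : (i.*2.+1 == j) && (i.*2 == k) = false by lia.
  by rewrite subr0.
rewrite {1}/lie /= /heis_lie /heis_form (eq_bigr _ (fun i _ => termE i)).
case: ifPn => [/andP[evj /eqP kj]|jk].
  have ltjm : (j./2 < m)%N by lia.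
  rewrite (bigD1 (Ordinal ltjm)) //= big1 ?addr0 => [|i].
    have -> : (j./2.*2 == j) && (j./2.*2.+1 == k) by lia.
    by rewrite scale1r.
  rewrite -val_eqE /= => neqi.
  by have -> : (i.*2 == j) && (i.*2.+1 == k) = false by lia.
rewrite big1 ?scale0r // => i _.
by have -> : (i.*2 == j) && (i.*2.+1 == k) = false by lia.
Qed.

Lemma lie_heis_basisZ (k : nat) : lie (heis_basis k) heis_Z = 0.
Proof. by rewrite -[heis_Z]scale1r; exact: heis_lieZr. Qed.

End Heisenberg.

Section DirectSum.
Variables (K : fieldType) (L1 L2 : lieAlgType K).

Definition pair_lie (u v : L1 * L2) : L1 * L2 := (lie u.1 v.1, lie u.2 v.2).

Fact pair_lie_linearl v : linear (pair_lie^~ v).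
Proof. by move=> a x y; rewrite /pair_lie /= !lie_linearl. Qed.

Fact pair_lie_linearr u : linear (pair_lie u).
Proof. by move=> a x y; rewrite /pair_lie /= !lie_linearr. Qed.

Fact pair_liexx u : pair_lie u u = 0.
Proof. by rewrite /pair_lie !liexx. Qed.

Fact pair_lie_jacobi u v w :
  pair_lie u (pair_lie v w) + pair_lie v (pair_lie w u)
  + pair_lie w (pair_lie u v) = 0.
Proof. by apply/eqP; rewrite -pair_eqE /= !lie_jacobi !eqxx. Qed.

HB.instance Definition _ := Vector_isLie.Build K (L1 * L2)%type
  pair_lie_linearl pair_lie_linearr pair_liexx pair_lie_jacobi.

End DirectSum.

Section RationalForms.
Variables (R : realType) (L : lieAlgType R).
Implicit Types V : set L.

Definition rat_subspace V :=
  [/\ V 0, (forall u v, V u -> V v -> V (u + v))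
    & (forall (q : rat) v, V v -> V (ratr q *: v))].

Definition rat_comb n (b : n.-tuple L) (c : 'I_n -> rat) : L :=
  \sum_(i < n) ratr (c i) *: tnth b i.

Definition rat_free n (b : n.-tuple L) :=
  forall c, rat_comb b c = 0 -> forall i, c i = 0.

Definition rat_basis V n (b : n.-tuple L) :=
  [/\ forall i, V (tnth b i), rat_free b
    & forall v, V v -> exists c, v = rat_comb b c].

Definition rat_dim V n := exists b : n.-tuple L, rat_basis V b.

(* The canonical R-linear map from V (x)_Q R to L, sending v (x) a to a *: v,
   is injective iff families of V that are free over Q are free over R. *)
Definition scalar_ext_inj V :=
  forall n (b : n.-tuple L), (forall i, V (tnth b i)) -> rat_free b -> free b.

Definition scalar_ext_surj V :=
  forall x, exists n (b : n.-tuple L),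
    (forall i, V (tnth b i)) /\ x \in <<b>>%VS.

Definition rational_form V :=
  [/\ rat_subspace V, rat_dim V (\dim {:L}),
      (forall u v, V u -> V v -> V (lie u v))
    & scalar_ext_inj V /\ scalar_ext_surj V].

Definition lie_automorphism (A : {linear L -> L}) :=
  bijective A /\ {morph A : u v / lie u v}.

Definition rational_form_iso V1 V2 :=
  exists A : {linear L -> L}, lie_automorphism A /\ A @` V1 = V2.

End RationalForms.

(* Main.v *)
Require Import Defs.
From HB Require Import structures.
From mathcomp Require Import all_boot all_order all_algebra.
From mathcomp Require Import boolp classical_sets reals.
From mathcomp Require Import ring.

(* Write [lie u v = (form1 u v *: Z, form2 u v *: Z')], and let V be a rational
   form. The centraliser of an element v of V is defined over Q. If v is not
   central in either factor, the h_3-components of its centraliser are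
   proportional modulo Z, so the commutators of the centraliser span the line of
   Z'. Hence that line is defined over Q, form1 is rational on V up to a scalar,
   and its radical h_5 + R Z is defined over Q. Rational symplectic Gram-Schmidt
   for form2 there gives Y1, ..., Y4 in V with [Y1, Y2] = [Y3, Y4]; projecting
   two further elements of V off the Y's gives X1, X2 in V commuting with them.
   Sending the standard basis to X1, X2, [X1, X2], Y1, ..., Y4, [Y1, Y2] is an
   automorphism carrying the standard rational form onto V. *)

Import GRing.Theory.
Local Open Scope ring_scope.

(** * Rational coordinates in [V], and detecting nonzero linear maps on [V] *)

Section RationalStructure.
Context {R : realType} {L : lieAlgType R} {V : set L}.

(** Prepending [v] to [b] gives a family of [V] that is dependent over the reals, hence over the
    rationals by [scalar_ext_inj]. In a rational relation the coefficient of [v] is nonzero because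
    [b] is free, and dividing by it exhibits every [r i] as a rational. *)
Lemma rational_coeffs {n} {b : n.-tuple L} (r : 'I_n -> R) :
    scalar_ext_inj V -> (forall i, V (tnth b i)) -> free b ->
    V (\sum_i r i *: tnth b i) ->
  forall i, exists q : rat, r i = ratr q.
Proof.
move=> Vinj Vb fb; set v := \sum_i _ => Vv i.
have b0 (k : 'I_n -> R) : \sum_j k j *: tnth b j = 0 -> forall j, k j = 0.
  move=> k0; move/freeP: fb; apply; rewrite -[RHS]k0.
  by apply: eq_bigr => j _; rewrite (tnth_nth 0).
have nfree : ~~ free [tuple of v :: b].
  rewrite free_cons negb_and negbK memv_suml// => j _.
  by rewrite memvZ ?memv_span ?mem_tnth.
have [c c0 [j cj]] : exists2 c, rat_comb [tuple of v :: b] c = 0 &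
    exists j, c j <> 0.
  apply: contrapT => rf; case/negP: nfree; apply: Vinj => [j|c c0 j].
    by case: (unliftP ord0 j) => [k|] ->; rewrite ?tnthS ?tnth0.
  by apply: contrapT => cj; apply: rf; exists c => //; exists j.
have {}c0 k : ratr (c ord0) * r k + ratr (c (lift ord0 k)) = 0.
  move: k; apply: b0; rewrite -[RHS]c0 /rat_comb big_ord_recl tnth0.
  rewrite scaler_sumr -big_split /=; apply: eq_bigr => k _.
  by rewrite tnthS scalerDl scalerA.
(* Otherwise [c0] would make all the coefficients of [b] vanish too, so the relation would be
   trivial. *)
have c00 : c ord0 != 0.
  apply/eqP => c00; apply: cj.
  case: (unliftP ord0 j) => [k|] -> //; move: (c0 k).
  by rewrite c00 rmorph0 mul0r add0r => /eqP; rewrite fmorph_eq0 => /eqP.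
exists (- (c (lift ord0 i) / c ord0)).
rewrite rmorphN fmorph_div /=; apply: (mulfI (x := ratr (c ord0))).
  by rewrite fmorph_eq0.
rewrite mulrN mulrCA mulfV ?mulr1 ?fmorph_eq0//.
by apply/eqP; rewrite -addr_eq0 c0.
Qed.

Hypothesis Vsurj : scalar_ext_surj V.

(** [V] spans [L] over the reals, so a linear form that vanishes on [V] vanishes everywhere. This
    moves generic real choices into [V]. *)
Lemma exists_nonzero {f : L -> R} {x} :
  scalar f -> f x != 0 -> exists2 v, V v & f v != 0.
Proof.
move=> flin fx; apply: contrapT => f0; move/eqP: fx; apply.
pose F : {scalar L} := HB.pack f (GRing.isLinear.Build R L R _ f flin).
have [n [b [Vb xb]]] := Vsurj x.
rewrite (coord_span xb) -[f]/(F : L -> R) linear_sum big1// => i _.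
rewrite linearZ /= -tnth_nth; apply/eqP; rewrite mulf_eq0; apply/orP; right.
by apply/negPn/negP => fb; apply: f0; exists (tnth b i).
Qed.

Lemma exists_nonzero2 {g : L -> L -> R} {x y} :
    (forall v, scalar (g^~ v)) -> (forall u, scalar (g u)) -> g x y != 0 ->
  exists u w, [/\ V u, V w & g u w != 0].
Proof.
move=> gl gr /(exists_nonzero (gl y))[u Vu /(exists_nonzero (gr u))[w Vw]].
by exists u, w.
Qed.

End RationalStructure.

(** * Alternating forms and symplectic projections *)

Section AlternatingForm.
Context {R : fieldType} {L : lmodType R} (w : L -> L -> R).
Hypotheses (wPl : forall v, scalar (w^~ v)) (wxx : forall u, w u u = 0).

Lemma altDl x y v : w (x + y) v = w x v + w y v.
Proof. by have := wPl v 1 x y; rewrite scale1r mul1r. Qed.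

Lemma alt0l v : w 0 v = 0.
Proof. by have := wPl v (-1) 0 0; rewrite scaler0 addr0 mulN1r addNr. Qed.

Lemma altZl a x v : w (a *: x) v = a * w x v.
Proof. by have := wPl v a x 0; rewrite addr0 alt0l addr0. Qed.

Lemma altNl x v : w (- x) v = - w x v.
Proof. by rewrite -scaleN1r altZl mulN1r. Qed.

Hypothesis wC : forall u v, w u v = - w v u.

Lemma alt0r v : w v 0 = 0.
Proof. by rewrite wC alt0l oppr0. Qed.

Lemma altDr x y v : w v (x + y) = w v x + w v y.
Proof. by rewrite wC altDl opprD -!wC. Qed.

Lemma altZr a x v : w v (a *: x) = a * w v x.
Proof. by rewrite wC altZl -mulrN -wC. Qed.

Lemma altNr x v : w v (- x) = - w v x.
Proof. by rewrite wC altNl -wC. Qed.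

Definition alt_lin := (altDl, altDr, altZl, altZr, altNl, altNr, alt0l, alt0r).

(* The projection onto the [w]-orthogonal of the plane spanned by [a] and [b]. *)
Definition alt_proj a b u : L := u - (w u b / w a b) *: a + (w u a / w a b) *: b.

Lemma alt_proj_linear a b : linear (alt_proj a b).
Proof.
move=> k x y; rewrite /alt_proj !alt_lin !mulrDl !scalerDl opprD.
rewrite (addrACA (k *: x)) (addrACA (k *: x + _)); congr (_ + _).
by rewrite scalerDr scalerBr !scalerA !mulrA.
Qed.

Lemma alt_proj_orthl a b u : w a b != 0 -> w (alt_proj a b u) a = 0.
Proof.
by move=> ab; rewrite /alt_proj !alt_lin wxx (wC b a); field.
Qed.

Lemma alt_proj_orthr a b u : w a b != 0 -> w (alt_proj a b u) b = 0.
Proof.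
by move=> ab; rewrite /alt_proj !alt_lin wxx; field.
Qed.

Lemma alt_proj_id a b u : w u a = 0 -> w u b = 0 -> alt_proj a b u = u.
Proof. by rewrite /alt_proj => -> ->; rewrite !mul0r !scale0r subr0 addr0. Qed.

End AlternatingForm.

(** * The commutator forms of the Heisenberg algebras *)

Section HeisForm.
Context {K : fieldType} {m : nat}.
Implicit Types (u v w : heisenberg K m) (a : K).

Lemma heis_formPl v : scalar ((@heis_form K m)^~ v).
Proof.
move=> a x y; rewrite /heis_form mulr_sumr -big_split /=.
by apply: eq_bigr => i _; rewrite !mxE; ring.
Qed.

Lemma heis_formPr u : scalar (@heis_form K m u).
Proof.
move=> a x y; rewrite /heis_form mulr_sumr -big_split /=.
by apply: eq_bigr => i _; rewrite !mxE; ring.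
Qed.

Lemma heis_formC u v : heis_form u v = - heis_form v u.
Proof.
rewrite /heis_form -sumrN; apply: eq_bigr => i _; ring.
Qed.

Lemma heis_formxx u : heis_form u u = 0.
Proof. by rewrite /heis_form big1// => i _; rewrite mulrC subrr. Qed.

End HeisForm.

Notation heis_form_lin := (alt_lin _ heis_formPl heis_formC).

Section Forms.
Context {K : fieldType}.

Lemma heis_form1E (u v : heisenberg K 1) :
  heis_form u v = u 0 (inord 0) * v 0 (inord 1) - u 0 (inord 1) * v 0 (inord 0).
Proof. by rewrite /heis_form big_ord_recl big_ord0 addr0. Qed.

Lemma heis_form2E (u v : heisenberg K 2) :
  heis_form u v =
  u 0 (inord 0) * v 0 (inord 1) - u 0 (inord 1) * v 0 (inord 0)
  + (u 0 (inord 2) * v 0 (inord 3) - u 0 (inord 3) * v 0 (inord 2)).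
Proof. by rewrite /heis_form !big_ord_recl big_ord0 addr0. Qed.

(** The three-term Plücker relation: on [heisenberg K 1] the form is the 2 by 2 determinant of the
    non-central coordinates. *)
Lemma heis_form1_plucker (u v w x : heisenberg K 1) :
  heis_form u v * heis_form w x =
  heis_form u w * heis_form v x - heis_form u x * heis_form v w.
Proof. rewrite !heis_form1E; ring. Qed.

Lemma heis_form_basis m (j k : nat) : (j < k < m.*2)%N ->
  heis_form (heis_basis K m j) (heis_basis K m k)
  = (~~ odd j && (k == j.+1))%:R.
Proof.
move=> jkm; have := lie_heis_basis K jkm; rewrite /lie /= /heis_lie.
move=> /rowP /(_ ord_max); rewrite !mxE !eqxx mulr1 => ->.
by case: ifP => _; rewrite !mxE ?eqxx.
Qed.

(* A form a /\ b has zero Pfaffian, while that of [heis_form] is 1. *)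
Lemma heis_form2_indecomposable (a b : heisenberg K 2 -> K) :
  exists e f, heis_form e f != a e * b f - b e * a f.
Proof.
apply: contrapT => H.
have {}H e f : heis_form e f = a e * b f - b e * a f.
  by apply: contrapT => /eqP ef; apply: H; exists e, f.
pose e := heis_basis K 2.
suff : heis_form (e 0) (e 1) * heis_form (e 2) (e 3)
    - heis_form (e 0) (e 2) * heis_form (e 1) (e 3)
    + heis_form (e 0) (e 3) * heis_form (e 1) (e 2) = 0.
  by rewrite !heis_form_basis//= !mulr0 mulr1 subr0 addr0; apply/eqP/oner_neq0.
rewrite !H; ring.
Qed.

End Forms.

(** * The two commutator forms on the direct sum, and adapted frames *)

Section Pair.
Context {R : realType}.
Local Notation L := (heisenberg R 1 * heisenberg R 2)%type.

Definition form1 (u v : L) := heis_form u.1 v.1.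
Definition form2 (u v : L) := heis_form u.2 v.2.

Lemma lie_pairE (u v : L) :
  lie u v = (form1 u v *: heis_Z R 1, form2 u v *: heis_Z R 2).
Proof. by []. Qed.

Lemma form1Pl v : scalar (form1^~ v).
Proof. by move=> a x y; exact: heis_formPl. Qed.

Lemma form2Pl v : scalar (form2^~ v).
Proof. by move=> a x y; exact: heis_formPl. Qed.

Lemma form1Pr u : scalar (form1 u).
Proof. by move=> a x y; exact: heis_formPr. Qed.

Lemma form2Pr u : scalar (form2 u).
Proof. by move=> a x y; exact: heis_formPr. Qed.

Lemma form1C u v : form1 u v = - form1 v u. Proof. exact: heis_formC. Qed.
Lemma form2C u v : form2 u v = - form2 v u. Proof. exact: heis_formC. Qed.
Lemma form1xx u : form1 u u = 0. Proof. exact: heis_formxx. Qed.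
Lemma form2xx u : form2 u u = 0. Proof. exact: heis_formxx. Qed.

End Pair.

Notation form1_lin := (alt_lin _ form1Pl form1C).
Notation form2_lin := (alt_lin _ form2Pl form2C).

(* [form2 X1 X2] is left free: [lie X1 X2] only has to be central and
   independent of [lie Y1 Y2]. *)
Set Implicit Arguments.
Record frame {R : realType} (X1 X2 Y1 Y2 Y3 Y4 : heisenberg R 1 * heisenberg R 2)
    : Prop := Frame {
  frameX12 : form1 X1 X2 != 0;
  frameY1 : forall u, form1 Y1 u = 0;
  frameY2 : forall u, form1 Y2 u = 0;
  frameY3 : forall u, form1 Y3 u = 0;
  frameY4 : forall u, form1 Y4 u = 0;
  frameY12 : form2 Y1 Y2 != 0;
  frameY34 : form2 Y3 Y4 = form2 Y1 Y2;
  frameY31 : form2 Y3 Y1 = 0;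
  frameY32 : form2 Y3 Y2 = 0;
  frameY41 : form2 Y4 Y1 = 0;
  frameY42 : form2 Y4 Y2 = 0;
  frameX1Y1 : form2 X1 Y1 = 0;
  frameX1Y2 : form2 X1 Y2 = 0;
  frameX1Y3 : form2 X1 Y3 = 0;
  frameX1Y4 : form2 X1 Y4 = 0;
  frameX2Y1 : form2 X2 Y1 = 0;
  frameX2Y2 : form2 X2 Y2 = 0;
  frameX2Y3 : form2 X2 Y3 = 0;
  frameX2Y4 : form2 X2 Y4 = 0
}.
Unset Implicit Arguments.

(** * Rational structure of the commutators and construction of a frame inside [V] *)

Section RationalForm.
Context {R : realType}.
Local Notation L := (heisenberg R 1 * heisenberg R 2)%type.
Context {V : set L}.
Hypothesis VR : rational_form V.

Let VD u v : V u -> V v -> V (u + v).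
Proof. by case: VR => -[_ H _] *; apply: H. Qed.
Let VZ (q : rat) v : V v -> V (ratr q *: v).
Proof. by case: VR => -[_ _ H] *; apply: H. Qed.
Let Vlie u v : V u -> V v -> V (lie u v).
Proof. by case: VR => _ _ H _; apply: H. Qed.
Let Vinj : scalar_ext_inj V. Proof. by case: VR => _ _ _ []. Qed.
Let Vsurj : scalar_ext_surj V. Proof. by case: VR => _ _ _ []. Qed.

(** The hypothesis is the nonvanishing of the determinant of the two brackets in central
    coordinates; Cramer's rule kills the coefficients of any relation. *)
Lemma lie_free (u v u' v' : L) :
  form1 u v * form2 u' v' - form2 u v * form1 u' v' != 0 ->
  free [:: lie u v; lie u' v'].
Proof.
move=> D0; apply/(@freeP _ _ 2 [tuple lie u v; lie u' v']) => k.
rewrite !big_ord_recl big_ord0 /= addr0 !lie_pairE => /eqP.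
rewrite -pair_eqE /= => /andP[/eqP/rowP/(_ ord_max) + /eqP/rowP/(_ ord_max)].
rewrite !mxE !eqxx /= !mulr1 => e1 e2.
have e3 : k ord0 = 0.
  apply: (mulIf D0); rewrite mul0r.
  transitivity ((k ord0 * form1 u v + k (lift ord0 ord0) * form1 u' v') *
    form2 u' v' - (k ord0 * form2 u v + k (lift ord0 ord0) * form2 u' v') *
    form1 u' v'); first by ring.
  by rewrite e1 e2; ring.
have e4 : k (lift ord0 ord0) = 0.
  apply: (mulIf D0); rewrite mul0r.
  transitivity ((k ord0 * form2 u v + k (lift ord0 ord0) * form2 u' v') *
    form1 u v - (k ord0 * form1 u v + k (lift ord0 ord0) * form1 u' v') *
    form2 u v); first by ring.
  by rewrite e1 e2; ring.
by move=> i; case: (unliftP ord0 i) => [j|] -> //; rewrite (ord1 j).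
Qed.

Lemma rational_coeffs2 (a b : L) (r s : R) :
    V a -> V b -> free [:: a; b] -> V (r *: a + s *: b) ->
  (exists q : rat, r = ratr q) /\ (exists q : rat, s = ratr q).
Proof.
move=> Va Vb fab Vv.
pose k (i : 'I_2) := if i == ord0 then r else s.
have Vab (i : 'I_2) : V (tnth [tuple a; b] i).
  by case: (unliftP ord0 i) => [j|] ->; rewrite ?tnthS ?(ord1 j) tnth0.
have H : forall i, exists q : rat, k i = ratr q.
  apply: (rational_coeffs k Vinj Vab fab).
  by rewrite !big_ord_recl big_ord0 addr0 tnthS !tnth0.
by split; [exact: (H ord0)|exact: (H (lift ord0 ord0))].
Qed.

Lemma rational_coeff1 (a : L) (r : R) :
  V a -> a != 0 -> V (r *: a) -> exists q : rat, r = ratr q.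
Proof.
move=> Va a0 Vra.
have Va1 (i : 'I_1) : V (tnth [tuple a] i) by rewrite (ord1 i) tnth0.
apply: (rational_coeffs (fun=> r) Vinj Va1 _ _ ord0).
  by rewrite /= seq1_free.
by rewrite big_ord_recl big_ord0 addr0.
Qed.

(** First a [v] in [V] outside the radicals of both forms is found; then the bilinear determinant
    attached to [v] is nonzero somewhere, hence somewhere on [V]. *)
Lemma rational_form_generic : exists v p q,
  [/\ V v, V p, V q & form1 v p * form2 v q - form2 v p * form1 v q != 0].
Proof.
have [v Vv [[p v1p] [q v2q]]] : exists2 v, V v &
    (exists p, form1 v p != 0) /\ (exists q, form2 v q != 0).
  have [a [c [Va Vc ac]]] : exists a c, [/\ V a, V c & form1 a c != 0].
    apply: (exists_nonzero2 Vsurj (x := (heis_basis R 1 0, 0))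
      (y := (heis_basis R 1 1, 0)) form1Pl form1Pr).
    by rewrite /form1 heis_form_basis ?oner_neq0.
  have [a' [c' [Va' Vc' ac']]] : exists a c, [/\ V a, V c & form2 a c != 0].
    apply: (exists_nonzero2 Vsurj (x := (0, heis_basis R 2 0))
      (y := (0, heis_basis R 2 1)) form2Pl form2Pr).
    by rewrite /form2 heis_form_basis ?oner_neq0.
  have [[p a'p]|a'0] := pselect (exists p, form1 a' p != 0).
    by exists a' => //; split; [exists p|exists c'].
  have [[q aq]|a0] := pselect (exists q, form2 a q != 0).
    by exists a => //; split; [exists c|exists q].
  (* Here [a'] lies in the radical of [form1] and [a] in that of [form2], so [c] still detects the
     sum through [form1] and [c'] through [form2]. *)
  exists (a + a'); first exact: VD.
  split; [exists c|exists c'].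
    rewrite form1_lin; have -> : form1 a' c = 0; last by rewrite addr0.
    by apply: contrapT => /eqP a'c; apply: a'0; exists c.
  rewrite form2_lin; have -> : form2 a c' = 0; last by rewrite add0r.
  by apply: contrapT => /eqP ac2; apply: a0; exists c'.
exists v.
(* Truncating [p] and [q] to one factor each makes the second product of the determinant vanish and
   leaves [form1 v p * form2 v q]. *)
have [||| p' [q' [? ? ?]]] := @exists_nonzero2 _ _ _ Vsurj
    (fun p q => form1 v p * form2 v q - form2 v p * form1 v q) (p.1, 0) (0, q.2).
- by move=> y a x z; rewrite form1Pr form2Pr; ring.
- by move=> y a x z; rewrite form1Pr form2Pr; ring.
- rewrite /form1 /form2 /=.
  rewrite heis_form_lin mul0r subr0.
  by rewrite mulf_neq0.
by exists p', q'.
Qed.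

(** The bracket [lie u w] is then a nonzero element of [V] on the line of the centre of the second
    factor. Both [u] and [w] are taken in the centraliser of a generic [v]. *)
Lemma rational_form_line2 : exists u w,
  [/\ V u, V w, form1 u w = 0 & form2 u w != 0].
Proof.
have [v [p [q [Vv Vp Vq D0]]]] := rational_form_generic.
set D := _ - _ in D0.
pose al u := (form1 v u * form2 v q - form2 v u * form1 v q) / D.
pose be u := (form1 v p * form2 v u - form2 v p * form1 v u) / D.
(* The projection [P] onto the centraliser of [v] along [p], [q] preserves [V]
   since the real coordinates of [lie v u] on the basis [lie v p], [lie v q] of
   the centre are rational. *)
pose P u := u - al u *: p - be u *: q.
have VP u : V u -> V (P u).
  move=> Vu;
  have lieE : lie v u = al u *: lie v p + be u *: lie v q.
    rewrite !lie_pairE; congr pair => /=; rewrite !scalerA -scalerDl;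
      congr (_ *: _); rewrite /al /be /D; field; exact: D0.
  have [||||[a aE] [b bE]] := @rational_coeffs2 (lie v p) (lie v q) (al u) (be u).
  - exact: Vlie.
  - exact: Vlie.
  - exact: lie_free.
  - by rewrite -lieE; exact: Vlie.
  rewrite /P aE bE -!scaleNr -!rmorphN /=.
  by apply: VD; [apply: VD => //|]; exact: VZ.
have Plin a x y : P (a *: x + y) = a *: P x + P y.
  have alE : al (a *: x + y) = a * al x + al y.
    by rewrite /al form1Pr form2Pr; ring.
  have beE : be (a *: x + y) = a * be x + be y.
    by rewrite /be form1Pr form2Pr; ring.
  rewrite /P alE beE !scalerBr !scalerDl !scalerA !opprD.
  by rewrite (addrACA (a *: x)) (addrACA (a *: x + _)).
have P1 u : form1 v (P u) = 0.
  by rewrite /P !form1_lin /al /be /D; field; exact: D0.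
have P2 u : form2 v (P u) = 0.
  by rewrite /P !form2_lin /al /be /D; field; exact: D0.
have Pid u : form1 v u = 0 -> form2 v u = 0 -> P u = u.
  by move=> u1 u2; rewrite /P /al /be u1 u2 !mulr0 !mul0r subr0 mul0r !scale0r !subr0.
have [d vd] : exists d : heisenberg R 2, heis_form v.2 d = 1.
  have [f v2f] : exists f, form2 v f != 0.
    apply: contrapT => v20; move/eqP: D0; apply.
    have z u : form2 v u = 0 by apply: contrapT => /eqP ?; apply: v20; exists u.
    by rewrite /D !z; ring.
  exists ((form2 v f)^-1 *: f.2).
  by rewrite heis_form_lin mulVf.
have [e [f ef]] := heis_form2_indecomposable
  (fun e => heis_form e d) (fun e => heis_form v.2 e).
(* The multiple of [d] is subtracted so that [C e] commutes with [v] and is fixed by [P]. On such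
   elements [form2] equals [heis_form] minus the decomposable form refuted by [e] and [f]. *)
pose C (e : heisenberg R 2) : L := (0, e - heis_form v.2 e *: d).
have [||| u [w [Vu Vw uw]]] := @exists_nonzero2 _ _ _ Vsurj
    (fun u w => form2 (P u) (P w)) (C e) (C f).
- by move=> y a x z; rewrite Plin form2Pl.
- by move=> y a x z; rewrite Plin form2Pr.
- have PC g : P (C g) = C g.
    apply: Pid; first by rewrite /form1 heis_form_lin.
    by rewrite /form2 /= !heis_form_lin vd mulr1 subrr.
  rewrite !PC /form2 /= -subr_eq0; move: ef; rewrite -subr_eq0; congr (_ != 0).
  rewrite !heis_form_lin heis_formxx (heis_formC d f); ring.
exists (P u), (P w); split; [exact: VP|exact: VP| |exact: uw].
have [g v1g] : exists g, form1 v g != 0.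
  apply: contrapT => v10; move/eqP: D0; apply.
  have z x : form1 v x = 0 by apply: contrapT => /eqP ?; apply: v10; exists x.
  by rewrite /D !z; ring.
(* By the Plücker relation, [form1 v g * form1 (P u) (P w)] is a combination of [form1 v (P u)] and
   [form1 v (P w)], which both vanish. *)
apply: (mulfI v1g); rewrite /form1 heis_form1_plucker.
by rewrite -/(form1 v (P u)) -/(form1 v (P w)) !P1 !mul0r subr0 mulr0.
Qed.

Lemma alt_proj_mem (w : L -> L -> R) a b u :
    V a -> V b -> V u ->
    (exists q : rat, w u a / w a b = ratr q) ->
    (exists q : rat, w u b / w a b = ratr q) ->
  V (alt_proj w a b u).
Proof.
move=> Va Vb Vu [x xE] [y yE]; rewrite /alt_proj xE yE -scaleNr -rmorphN.
by apply: VD; [apply: VD => //|]; exact: VZ.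
Qed.

(** With [u], [w] from [rational_form_line2], the brackets [lie c d] and [lie u w] form a basis of
    the centre made of elements of [V], so the coordinates of [lie a b] on it are rational. *)
Lemma rational_form1_ratio a b c d :
    V a -> V b -> V c -> V d -> form1 c d != 0 ->
  exists q : rat, form1 a b / form1 c d = ratr q.
Proof.
move=> Va Vb Vc Vd cd; have [u [w [Vu Vw uw1 uw2]]] := rational_form_line2.
(* These are the coordinates of [lie a b] on [lie c d] and [lie u w]; since [form1 u w = 0], the
   first factor alone determines [r], and the second then gives [s]. *)
set r := _ / _; pose s := (form2 a b - r * form2 c d) / form2 u w.
have [||||//] := @rational_coeffs2 (lie c d) (lie u w) r s.
- exact: Vlie.
- exact: Vlie.
- by apply: lie_free; rewrite uw1 mulr0 subr0 mulf_neq0.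
suff <- : lie a b = r *: lie c d + s *: lie u w by exact: Vlie.
rewrite !lie_pairE; congr pair => /=; rewrite !scalerA -scalerDl;
  congr (_ *: _).
  by rewrite uw1 mulr0 addr0 divfK.
by rewrite divfK// addrC subrK.
Qed.

(** Both brackets lie on the same central line, where two elements of [V] have a rational ratio. *)
Lemma rational_form2_ratio a b c d :
    V a -> V b -> V c -> V d -> form1 a b = 0 -> form1 c d = 0 ->
    form2 c d != 0 ->
  exists q : rat, form2 a b / form2 c d = ratr q.
Proof.
move=> Va Vb Vc Vd ab1 cd1 cd2; apply: (@rational_coeff1 (lie c d)).
- exact: Vlie.
- apply: contra cd2; rewrite lie_pairE cd1 => /eqP[_ /rowP/(_ ord_max)].
  by rewrite !mxE !eqxx mulr1 => /eqP.
suff -> : (form2 a b / form2 c d) *: lie c d = lie a b by exact: Vlie.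
rewrite !lie_pairE ab1 cd1; congr pair => /=; rewrite scalerA.
  by rewrite mulr0.
by rewrite divfK.
Qed.

(** Modulo the centre, [p.1] and [q.1] span the first factor, so a vector that is [form1]-orthogonal
    to [p] and [q] lies in the radical of [form1]. *)
Lemma alt_proj_form1 (p q u x : L) :
  form1 p q != 0 -> form1 (alt_proj form1 p q u) x = 0.
Proof.
move=> pq; apply: (mulfI pq); rewrite /alt_proj !form1_lin.
have := heis_form1_plucker p.1 q.1 u.1 x.1.
rewrite -!/(form1 _ _) (form1C p u) (form1C q u) => e.
rewrite mulrDr mulrBr e; field; exact: pq.
Qed.

Lemma rational_form_frame : exists X1 X2 Y1 Y2 Y3 Y4 : L,
  [/\ V X1, V X2, V Y1 & V Y2] /\ [/\ V Y3, V Y4 & frame X1 X2 Y1 Y2 Y3 Y4].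
Proof.
have [p [q [Vp Vq pq]]] : exists p q, [/\ V p, V q & form1 p q != 0].
  apply: (exists_nonzero2 Vsurj (x := (heis_basis R 1 0, 0))
    (y := (heis_basis R 1 1, 0)) form1Pl form1Pr).
  by rewrite /form1 heis_form_basis ?oner_neq0.
(* [T] projects onto the radical of [form1], and preserves [V] because the ratios of [form1] on [V]
   are rational. The vectors [Y1] to [Y4] are all built from values of [T]. *)
pose T := alt_proj form1 p q.
have VT u : V u -> V (T u).
  by move=> Vu; apply: alt_proj_mem => //; exact: rational_form1_ratio.
have T1 u x : form1 (T u) x = 0 by exact: alt_proj_form1.
have Tid e : T (0, e) = (0, e).
  by apply: alt_proj_id; rewrite /form1 /= heis_form_lin.
have Tlin a x y : T (a *: x + y) = a *: T x + T y.
  exact: (alt_proj_linear _ form1Pl).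
clearbody T.
have [||| u1 [u2 [Vu1 Vu2 Y12]]] := @exists_nonzero2 _ _ _ Vsurj
    (fun u w => form2 (T u) (T w)) (0, heis_basis R 2 0) (0, heis_basis R 2 1).
- by move=> y a x z; rewrite Tlin form2Pl.
- by move=> y a x z; rewrite Tlin form2Pr.
- by rewrite !Tid /form2 heis_form_basis ?oner_neq0.
set Y1 := T u1 in Y12; set Y2 := T u2 in Y12.
have VY1 : V Y1 by exact: VT.
have VY2 : V Y2 by exact: VT.
have Y1_1 x : form1 Y1 x = 0 by exact: T1.
have Y2_1 x : form1 Y2 x = 0 by exact: T1.
clearbody Y1 Y2.
have S_mem a b u : V a -> V b -> V u -> (forall x, form1 a x = 0) ->
    (forall x, form1 b x = 0) -> form2 a b != 0 -> V (alt_proj form2 a b u).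
  move=> Va Vb Vu a1 b1 ab; apply: alt_proj_mem => //;
    apply: rational_form2_ratio => //; by rewrite form1C ?a1 ?b1 oppr0.
have S_form1 a b u x : (forall x, form1 a x = 0) ->
    (forall x, form1 b x = 0) -> form1 (alt_proj form2 a b u) x = form1 u x.
  by move=> a1 b1; rewrite /alt_proj !form1_lin a1 b1 !mulr0 subr0 addr0.
pose S := alt_proj form2 Y1 Y2.
have Slin a x y : S (a *: x + y) = a *: S x + S y.
  exact: (alt_proj_linear _ form2Pl).
have VS u : V u -> V (S u) by move=> Vu; exact: S_mem.
have S1 u x : form1 (S u) x = form1 u x.
  by exact: S_form1.
have SY1 u : form2 (S u) Y1 = 0 := alt_proj_orthl _ form2Pl form2xx form2C _ _ u Y12.
have SY2 u : form2 (S u) Y2 = 0 := alt_proj_orthr _ form2Pl form2xx _ _ u Y12.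
have SE x z : form2 z Y1 = 0 -> form2 z Y2 = 0 -> form2 (S x) z = form2 x z.
  move=> z1 z2; rewrite /S /alt_proj !form2_lin (form2C Y1 z) (form2C Y2 z).
  by rewrite z1 z2 oppr0 !mulr0 subr0 addr0.
have SE' x y : form2 (S x) (S y) = form2 x (S y) by rewrite SE.
have [u3 [u4 [Vu3 Vu4 Y34]]] : exists u w, [/\ V u, V w & form2 (S (T u)) (S (T w)) != 0].
  (* On vectors [(0, e)], projecting by [S] subtracts from [form2] exactly this decomposable form,
     so what remains is nonzero on some pair. *)
  have [e [f ef]] := heis_form2_indecomposable
    (fun e => form2 (0, e) Y1 / form2 Y1 Y2) (fun e => form2 (0, e) Y2).
  apply: (@exists_nonzero2 _ _ _ Vsurj
    (fun u w => form2 (S (T u)) (S (T w))) (0, e) (0, f)).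
  - by move=> y a x z; rewrite Tlin Slin form2Pl.
  - by move=> y a x z; rewrite Tlin Slin form2Pr.
  rewrite !Tid SE' /S /alt_proj !form2_lin.
  move: ef; rewrite -subr_eq0; congr (_ != 0).
  by rewrite -/(form2 (0, e) (0, f)); ring.
(* Rescaling by [r] equates [form2 Y3 Y4] with [form2 Y1 Y2]; its rationality keeps [Y4] in [V]. *)
have [r rE] : exists r : rat, form2 Y1 Y2 / form2 (S (T u3)) (S (T u4)) = ratr r.
  by apply: rational_form2_ratio; rewrite ?S1 ?T1//; apply/VS/VT.
clearbody S.
set Y3 := S (T u3) in Y34 rE; set Y4 := ratr r *: S (T u4).
have VY3 : V Y3 by apply/VS/VT.
have VY4 : V Y4 by apply/VZ/VS/VT.
have Y31 x : form1 Y3 x = 0 by rewrite S1 T1.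
have Y41 x : form1 Y4 x = 0 by rewrite form1_lin S1 T1 mulr0.
have Y34' : form2 Y3 Y4 = form2 Y1 Y2 by rewrite form2_lin -rE divfK.
have Y34n : form2 Y3 Y4 != 0 by rewrite Y34'.
have Y41' : form2 Y4 Y1 = 0 by rewrite form2_lin SY1 mulr0.
have Y42' : form2 Y4 Y2 = 0 by rewrite form2_lin SY2 mulr0.
have Y31' : form2 Y3 Y1 = 0 by exact: SY1.
have Y32' : form2 Y3 Y2 = 0 by exact: SY2.
clearbody Y3 Y4.
(* [S'] removes the components along both symplectic planes. It leaves [form1] unchanged since the
   subtracted vectors lie in its radical, so [S' p] and [S' q] can serve as [X1] and [X2]. *)
pose S' u := alt_proj form2 Y3 Y4 (S u).
have VS' u : V u -> V (S' u) by move=> Vu; apply: S_mem => //; exact: VS.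
have S'1 u x : form1 (S' u) x = form1 u x by rewrite S_form1.
have S'Y u : [/\ form2 (S' u) Y1 = 0, form2 (S' u) Y2 = 0, form2 (S' u) Y3 = 0
    & form2 (S' u) Y4 = 0].
  rewrite /S'; move: (S u) (SY1 u) (SY2 u) => z z1 z2; split.
  - by rewrite /alt_proj !form2_lin z1 Y31' Y41' !mulr0 subr0 addr0.
  - by rewrite /alt_proj !form2_lin z2 Y32' Y42' !mulr0 subr0 addr0.
  - exact: (alt_proj_orthl _ form2Pl form2xx form2C).
  - exact: (alt_proj_orthr _ form2Pl form2xx).
have [[? ? ? ?] [? ? ? ?]] := (S'Y p, S'Y q).
exists (S' p), (S' q), Y1, Y2, Y3, Y4; split; first by split=> //; exact: VS'.
split=> //; split; rewrite //; by rewrite S'1 form1C S'1 -form1C.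
Qed.

End RationalForm.

(** * The automorphism determined by a frame *)

Section Frame.
Context {R : realType}.
Local Notation L := (heisenberg R 1 * heisenberg R 2)%type.

Lemma form1_lie (x y z : L) : form1 (lie x y) z = 0.
Proof.
rewrite form1C; have := heis_lieZr z.1 (form1 x y).
rewrite /heis_lie -/(form1 z (lie x y)) => /rowP/(_ ord_max).
by rewrite !mxE !eqxx mulr1 => ->; rewrite oppr0.
Qed.

Lemma form2_lie (x y z : L) : form2 (lie x y) z = 0.
Proof.
rewrite form2C; have := heis_lieZr z.2 (form2 x y).
rewrite /heis_lie -/(form2 z (lie x y)) => /rowP/(_ ord_max).
by rewrite !mxE !eqxx mulr1 => ->; rewrite oppr0.
Qed.

Context {X1 X2 Y1 Y2 Y3 Y4 : L}.

Definition frame_map (X1 X2 Y1 Y2 Y3 Y4 : L) (u : L) : L :=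
  \sum_(i < 3) u.1 0 (inord i) *: [:: X1; X2; lie X1 X2]`_i
  + \sum_(i < 5) u.2 0 (inord i) *: [:: Y1; Y2; Y3; Y4; lie Y1 Y2]`_i.

Local Notation A := (frame_map X1 X2 Y1 Y2 Y3 Y4).

Lemma frame_map_linear : linear A.
Proof.
move=> a x y; rewrite /frame_map scalerDr addrACA !scaler_sumr -!big_split /=.
congr (_ + _); apply: eq_bigr => i _.
  by rewrite /= !mxE scalerDl scalerA.
by rewrite /= !mxE scalerDl scalerA.
Qed.

Lemma frame_mapE u : A u =
  u.1 0 (inord 0) *: X1 + (u.1 0 (inord 1) *: X2 + u.1 0 (inord 2) *: lie X1 X2)
  + (u.2 0 (inord 0) *: Y1 + (u.2 0 (inord 1) *: Y2 + (u.2 0 (inord 2) *: Y3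
     + (u.2 0 (inord 3) *: Y4 + u.2 0 (inord 4) *: lie Y1 Y2)))).
Proof. by rewrite /frame_map !big_ord_recl !big_ord0 !addr0. Qed.

Lemma frame_map_lie u v :
  A (lie u v) = form1 u v *: lie X1 X2 + form2 u v *: lie Y1 Y2.
Proof.
have Zmax m : heis_Z R m 0 (inord m.*2) = 1.
  by rewrite mxE eqxx -val_eqE /= inordK ?eqxx.
have Zlt m k : (k < m.*2)%N -> heis_Z R m 0 (inord k) = 0.
  move=> km; rewrite mxE eqxx -val_eqE /= inordK; last exact: ltnW.
  by rewrite (ltn_eqF km).
have Z1 : heis_Z R 1 0 (inord 2) = 1 := Zmax 1%N.
have Z2 : heis_Z R 2 0 (inord 4) = 1 := Zmax 2%N.
have ZE m a j : (a *: heis_Z R m : heisenberg R m) 0 j = a * heis_Z R m 0 j.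
  by rewrite mxE.
rewrite frame_mapE lie_pairE /= !ZE Z1 Z2 !Zlt//.
by rewrite !mulr0 !mulr1 !scale0r !add0r.
Qed.

Hypothesis F : frame X1 X2 Y1 Y2 Y3 Y4.

Lemma frame_map_form1 u v : form1 (A u) (A v) = form1 u v * form1 X1 X2.
Proof.
have E z x : form1 (A z) x = z.1 0 (inord 0) * form1 X1 x
    + z.1 0 (inord 1) * form1 X2 x.
  rewrite frame_mapE !form1_lin !form1_lie (frameY1 F) (frameY2 F) (frameY3 F).
  by rewrite (frameY4 F) !mulr0 !addr0.
rewrite E [form1 X1 _]form1C [form1 X2 _]form1C !E !form1xx (form1C X2 X1).
by rewrite [form1 u v]heis_form1E; ring.
Qed.

(** The frame relations remove all the cross terms. The surviving [form2 X1 X2] matches the second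
    component of [lie X1 X2], which is why that value may stay arbitrary. *)
Lemma frame_map_form2 u v :
  form2 (A u) (A v) = form1 u v * form2 X1 X2 + form2 u v * form2 Y1 Y2.
Proof.
have E z x : form2 (A z) x =
    z.1 0 (inord 0) * form2 X1 x + z.1 0 (inord 1) * form2 X2 x
    + (z.2 0 (inord 0) * form2 Y1 x + z.2 0 (inord 1) * form2 Y2 x
    + (z.2 0 (inord 2) * form2 Y3 x + z.2 0 (inord 3) * form2 Y4 x)).
  by rewrite frame_mapE !form2_lin !form2_lie !mulr0 !addr0 !addrA.
rewrite E [form2 X1 (A v)]form2C [form2 X2 (A v)]form2C [form2 Y1 (A v)]form2C.
rewrite [form2 Y2 (A v)]form2C [form2 Y3 (A v)]form2C [form2 Y4 (A v)]form2C.
rewrite !E !form2xx (form2C X2 X1) (form2C Y2 Y1) (form2C Y4 Y3).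
rewrite (form2C Y1 X1) (form2C Y2 X1) (form2C Y3 X1) (form2C Y4 X1).
rewrite (form2C Y1 X2) (form2C Y2 X2) (form2C Y3 X2) (form2C Y4 X2).
rewrite (form2C Y1 Y3) (form2C Y2 Y3) (form2C Y1 Y4) (form2C Y2 Y4).
rewrite !(frameX1Y1 F, frameX1Y2 F, frameX1Y3 F, frameX1Y4 F).
rewrite !(frameX2Y1 F, frameX2Y2 F, frameX2Y3 F, frameX2Y4 F).
rewrite !(frameY31 F, frameY32 F, frameY41 F, frameY42 F) (frameY34 F).
by rewrite [form1 u v]heis_form1E [form2 u v]heis_form2E; ring.
Qed.

Lemma frame_map_morph : {morph A : u v / lie u v}.
Proof.
move=> u v; rewrite frame_map_lie [RHS]lie_pairE frame_map_form1 frame_map_form2.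
rewrite !lie_pairE (frameY1 F); congr pair => /=; rewrite !scalerA -scalerDl //.
by rewrite mulr0 addr0.
Qed.

(** If [A u = 0], every [A (lie u v)] vanishes, and independence of [lie X1 X2] and [lie Y1 Y2]
    forces [u] to be central. The same independence then kills the two central coordinates. *)
Lemma frame_map_eq0 u : A u = 0 -> u = 0.
Proof.
move=> Au0.
have free2 r s : r *: lie X1 X2 + s *: lie Y1 Y2 = 0 -> r = 0 /\ s = 0.
  rewrite !lie_pairE (frameY1 F) => -[/rowP/(_ ord_max) + /rowP/(_ ord_max)].
  rewrite !mxE !eqxx /= !mulr1 mulr0 addr0 => /eqP.
  rewrite mulf_eq0 (negbTE (frameX12 F)) orbF => /eqP -> /eqP.
  by rewrite mul0r add0r mulf_eq0 (negbTE (frameY12 F)) orbF => /eqP ->.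
have u0 v : form1 u v = 0 /\ form2 u v = 0.
  apply: free2; rewrite -frame_map_lie frame_map_morph Au0.
  by rewrite lie_pairE (alt0l _ form1Pl) (alt0l _ form2Pl) !scale0r.
have e1 (i j : nat) : (i < 3)%N -> (j < 3)%N -> heis_basis R 1 i 0 (inord j) = (j == i)%:R.
  by move=> i3 j3; rewrite mxE eqxx -val_eqE /= !inordK.
have e2 (i j : nat) : (i < 5)%N -> (j < 5)%N -> heis_basis R 2 i 0 (inord j) = (j == i)%:R.
  by move=> i3 j3; rewrite mxE eqxx -val_eqE /= !inordK.
have u1 i : form1 u (heis_basis R 1 i, 0) = 0 by case: (u0 (heis_basis R 1 i, 0)).
have u2 i : form2 u (0, heis_basis R 2 i) = 0 by case: (u0 (0, heis_basis R 2 i)).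
have u10 : u.1 0 (inord 0) = 0.
  by rewrite -(u1 1%N) /form1 heis_form1E !e1//=; ring.
have u11 : u.1 0 (inord 1) = 0.
  by rewrite -[LHS]opprK -[RHS]oppr0 -(u1 0%N) /form1 heis_form1E !e1//=; ring.
have u20 : u.2 0 (inord 0) = 0.
  by rewrite -(u2 1%N) /form2 heis_form2E !e2//=; ring.
have u21 : u.2 0 (inord 1) = 0.
  by rewrite -[LHS]opprK -[RHS]oppr0 -(u2 0%N) /form2 heis_form2E !e2//=; ring.
have u22 : u.2 0 (inord 2) = 0.
  by rewrite -(u2 3%N) /form2 heis_form2E !e2//=; ring.
have u23 : u.2 0 (inord 3) = 0.
  by rewrite -[LHS]opprK -[RHS]oppr0 -(u2 2%N) /form2 heis_form2E !e2//=; ring.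
have [u12 u24] : u.1 0 (inord 2) = 0 /\ u.2 0 (inord 4) = 0.
  apply: free2; rewrite -[RHS]Au0 frame_mapE u10 u11 u20 u21 u22 u23.
  by rewrite !scale0r !add0r.
rewrite [u]surjective_pairing; congr pair; apply/rowP => i;
  rewrite mxE -[i]inord_val; case: i => -[|[|[|[|[|]]]]].
all: by move=> // ?.
Qed.

End Frame.

Local Open Scope classical_set_scope.

(** * Rational points of a real coordinate system *)

Section RationalPoints.
Context {R : realType} {L : lieAlgType R} {n : nat}.
Variables (phi : {linear L -> 'rV[R]_n}) (psi : 'rV[R]_n -> L).
Hypotheses (phiK : cancel phi psi) (psiK : cancel psi phi).

Definition rational_points : set L :=
  [set u | exists c : 'rV[rat]_n, phi u = map_mx ratr c].

Let e : n.-tuple L := [tuple psi (delta_mx 0 i) | i < n].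

Let phi_comb (k : 'I_n -> R) : phi (\sum_i k i *: tnth e i) = \row_i k i.
Proof.
rewrite linear_sum [RHS]row_sum_delta; apply: eq_bigr => i _.
by rewrite linearZ /= tnth_mktuple psiK mxE.
Qed.

Let span_e u : u \in <<e>>%VS.
Proof.
rewrite -(phiK u) [phi u](_ : _ = \row_i phi u 0 i).
  rewrite -phi_comb phiK memv_suml// => i _.
  by rewrite memvZ ?memv_span ?mem_tnth.
by apply/rowP => i; rewrite mxE.
Qed.

Let free_e : free e.
Proof.
apply/freeP => k k0 i; have := phi_comb k.
under eq_bigr do rewrite (tnth_nth 0).
by rewrite k0 linear0 => /rowP/(_ i); rewrite !mxE.
Qed.

Let dim_e : \dim {:L} = n.
Proof.
apply: (@size_basis _ _ _ _ e); rewrite basisEfree free_e subvf.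
by rewrite -(eqnP free_e); apply/dimvS/subvP => u _; exact: span_e.
Qed.

Let e_rat i : rational_points (tnth e i).
Proof. by exists (delta_mx 0 i); rewrite tnth_mktuple psiK map_delta_mx. Qed.

(** The coordinate basis [e] gives the dimension and surjectivity. Injectivity holds because the
    rank of a rational matrix does not change over the reals. *)
Lemma rational_points_form :
    (forall u v, rational_points u -> rational_points v ->
       rational_points (lie u v)) ->
  rational_form rational_points.
Proof.
move=> Vlie; split=> //; [split| |split].
- by exists 0; rewrite linear0 map_mx0.
- by move=> u v [c uc] [d vd]; exists (c + d); rewrite linearD uc vd map_mxD.
- by move=> q v [c vc]; exists (q *: c); rewrite linearZ vc map_mxZ.
- rewrite dim_e; exists e; split=> // [c c0 i|v [c vc]].
    have := phi_comb (ratr \o c); rewrite -/(rat_comb e c) c0 linear0.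
    by move=> /rowP/(_ i); rewrite !mxE => /esym/eqP; rewrite fmorph_eq0 => /eqP.
  exists (c 0); apply: (can_inj phiK); rewrite vc phi_comb.
  by apply/rowP => i; rewrite !mxE.
- move=> p b /choice[c bc] rfb.
  have combE (k : 'I_p -> R) :
      phi (\sum_i k i *: tnth b i) = (\row_i k i) *m map_mx ratr (\matrix_i c i).
    rewrite linear_sum mulmx_sum_row; apply: eq_bigr => i _.
    by rewrite linearZ /= bc mxE -map_row rowK.
  have Mfree : row_free (\matrix_i c i).
    apply: inj_row_free => w wM; apply/rowP => i; rewrite mxE.
    apply: (rfb (w 0)); apply: (can_inj phiK); rewrite combE linear0.
    rewrite [\row_i0 _](_ : _ = map_mx ratr w); last first.
      by apply/rowP => j; rewrite !mxE.
    by rewrite -map_mxM wM map_mx0.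
  apply/freeP => k k0 i; have := combE k.
  under eq_bigr do rewrite (tnth_nth 0).
  rewrite k0 linear0 -[0](mul0mx _ (map_mx ratr (\matrix_i0 c i0))).
  move=> /row_free_inj; rewrite row_free_map => /(_ Mfree)/rowP/(_ i).
  by rewrite !mxE.
- by move=> x; exists n, e.
Qed.

End RationalPoints.

(** * Symmetry and transitivity of isomorphism of rational forms *)

Section Iso.
Context {R : realType} {L : lieAlgType R}.

Lemma rational_form_iso_sym (V1 V2 : set L) :
  rational_form_iso V1 V2 -> rational_form_iso V2 V1.
Proof.
move=> [A [[[B AK BK] Alie] <-]].
have Blin : linear B := can2_linear AK BK.
pose B' : {linear L -> L} := HB.pack B (GRing.isLinear.Build R L L _ B Blin).
have Blie : {morph B : u v / lie u v}.
  by move=> u v; apply: (can_inj AK); rewrite BK Alie !BK.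
exists B'; split; first by split; [exists A|exact: Blie].
have {}AK : cancel A B' := AK.
apply/seteqP; split=> [_ [_ [x Vx <-] <-]|x Vx]; first by rewrite AK.
by exists (A x); [exists x|rewrite AK].
Qed.

Lemma rational_form_iso_trans (V1 V2 V3 : set L) :
  rational_form_iso V1 V2 -> rational_form_iso V2 V3 -> rational_form_iso V1 V3.
Proof.
move=> [A [[Abij Alie] <-]] [B [[Bbij Blie] <-]].
exists (B \o A : {linear L -> L}); split; last by rewrite image_comp.
by split=> [|u v] /=; [exact: bij_comp|rewrite Alie Blie].
Qed.

End Iso.

(** * The standard rational form and its uniqueness *)

Section Standard.
Context {R : realType}.
Local Notation L := (heisenberg R 1 * heisenberg R 2)%type.

Lemma heis_form_map m (c d : heisenberg rat m) :
  heis_form (map_mx ratr c : heisenberg R m) (map_mx ratr d) = ratr (heis_form c d).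
Proof.
rewrite /heis_form rmorph_sum; apply: eq_bigr => i _.
by rewrite !mxE rmorphB !rmorphM.
Qed.

Lemma heis_lie_map m (c d : heisenberg rat m) :
  heis_lie (map_mx ratr c : heisenberg R m) (map_mx ratr d)
  = map_mx ratr (heis_lie c d).
Proof.
rewrite /heis_lie heis_form_map map_mxZ; congr (_ *: _).
by rewrite /heis_Z map_delta_mx.
Qed.

Definition pair_coords (u : L) : 'rV[R]_(1.*2.+1 + 2.*2.+1) := row_mx u.1 u.2.
Definition pair_of_coords (c : 'rV[R]_(1.*2.+1 + 2.*2.+1)) : L :=
  (lsubmx c, rsubmx c).

Lemma pair_coordsK : cancel pair_coords pair_of_coords.
Proof. by move=> [a b]; rewrite /pair_of_coords row_mxKl row_mxKr. Qed.

Lemma pair_of_coordsK : cancel pair_of_coords pair_coords.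
Proof. by move=> c; exact: hsubmxK. Qed.

Fact pair_coords_linear : linear pair_coords.
Proof. by move=> a x y; rewrite /pair_coords scale_row_mx add_row_mx. Qed.

HB.instance Definition _ := GRing.isLinear.Build R L _ _ pair_coords
  pair_coords_linear.

Definition standard_form : set L := rational_points pair_coords.

Lemma standard_formP : rational_form standard_form.
Proof.
apply: (rational_points_form _ _ pair_coordsK pair_of_coordsK) => u v.
move=> [c uc] [d vd].
rewrite -(pair_coordsK u) -(pair_coordsK v) uc vd.
rewrite /pair_of_coords -!map_lsubmx -!map_rsubmx.
exists (row_mx (heis_lie (lsubmx c : heisenberg rat 1) (lsubmx d))
  (heis_lie (rsubmx c : heisenberg rat 2) (rsubmx d))).
by rewrite map_row_mx -!heis_lie_map.
Qed.

Lemma standard_form_iso (V : set L) :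
  rational_form V -> rational_form_iso standard_form V.
Proof.
move=> VR.
have [X1 [X2 [Y1 [Y2 [Y3 [Y4]]]]]] := rational_form_frame VR.
move=> [[VX1 VX2 VY1 VY2] [VY3 VY4 Fr]].
have [[V0 VD VZ] _ Vlie [Vinj _]] := VR.
pose A0 := frame_map X1 X2 Y1 Y2 Y3 Y4.
pose A : {linear L -> L} :=
  HB.pack A0 (GRing.isLinear.Build R L L _ A0 frame_map_linear).
(* An injective endomorphism of a finite-dimensional space is bijective; [linfun] supplies the
   inverse. *)
pose f := linfun A.
have kerf : lker f == 0%VS.
  apply/lker0P => x y; rewrite !lfunE => /eqP; rewrite -subr_eq0 -linearB.
  by move=> /eqP/(frame_map_eq0 Fr)/eqP; rewrite subr_eq0 => /eqP.
have AK : cancel A f^-1%VF by move=> x; rewrite -[A x]lfunE lker0_lfunK.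
have KA : cancel f^-1%VF A by move=> x; rewrite -[A _]lfunE lker0_lfunVK.
exists A; split.
  by split; [exists f^-1%VF|exact: frame_map_morph].
pose b (i : 'I_(1.*2.+1 + 2.*2.+1)) : L := match split i with
  | inl j => [:: X1; X2; lie X1 X2]`_j
  | inr j => [:: Y1; Y2; Y3; Y4; lie Y1 Y2]`_j end.
have AE u : A u = \sum_i pair_coords u 0 i *: b i.
  rewrite big_split_ord /=; congr (_ + _); apply: eq_bigr => i _.
    by rewrite inord_val /b (unsplitK (inl i)) row_mxEl.
  by rewrite inord_val /b (unsplitK (inr i)) row_mxEr.
have Vb i : V (b i).
  rewrite /b; case: split => -[[|[|[|[|[|]]]]]] //= _; exact: Vlie.
have freeb : free [tuple b i | i < _].
  apply/freeP => k k0 i; pose u := pair_of_coords (\row_i k i).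
  have Au0 : A u = 0.
    rewrite AE -[RHS]k0; apply: eq_bigr => j _.
    by rewrite pair_of_coordsK mxE -tnth_nth tnth_mktuple.
  have := pair_of_coordsK (\row_i k i).
  by rewrite -/u (frame_map_eq0 Fr _ Au0) linear0 => /rowP/(_ i); rewrite !mxE.
apply/seteqP; split=> [_ [u [c uc] <-]|v Vv].
  rewrite AE; elim/big_ind: _ => // i _; rewrite uc mxE; exact: VZ.
exists (f^-1%VF v); last exact: KA.
(* The coordinates of the preimage of [v] are the coefficients of [v] on the free family [b] of [V],
   hence rational. *)
have /choice[c cE] i : exists q : rat, pair_coords (f^-1%VF v) 0 i = ratr q.
  move: i; apply: (rational_coeffs _ Vinj _ freeb) => [i|].
    by rewrite tnth_mktuple.
  under eq_bigr do rewrite tnth_mktuple.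
  by rewrite -AE KA.
by exists (\row_i c i); apply/rowP => i; rewrite [LHS]cE !mxE.
Qed.

End Standard.

Theorem proposition2p10 (R : realType) :
  let n := (heisenberg R 1 * heisenberg R 2)%type in
  (exists V : set n, rational_form V) /\
  (forall V1 V2 : set n,
     rational_form V1 -> rational_form V2 -> rational_form_iso V1 V2).
Proof.
split=> [|V1 V2 /standard_form_iso V1R /standard_form_iso V2R].
  by exists standard_form; exact: standard_formP.
exact: rational_form_iso_trans (rational_form_iso_sym _ _ V1R) V2R.
Qed.
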